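(* For $n\ge 0$ and $k\ge 0$, the number $t_{n,k}$ of tilings of the honeycomb strip $H_n$ by monomers, slanted dimers and trimers using exactly $k$ trimers is $$t_{n,k}=\sum_{\substack{i_0,\dots,i_k\ge 0\\ i_0+\cdots+i_k=n-2k+1}}F_{i_0}F_{i_1}\cdots F_{i_k},$$ where $F_j$ are the Fibonacci numbers ($F_0=0$, $F_1=1$, $F_j=F_{j-1}+F_{j-2}$).
   Context: The honeycomb strip $H_n$ consists of $n$ regular hexagons numbered $1,\dots,n$ arranged in two rows (odd-numbered on the bottom, even-numbered on top), hexagon $i$ sharing an edge with hexagons $i\pm1$ and $i\pm2$. The allowed tiles are: monomers $\{i\}$, slanted dimers $\{i,i+1\}$, and trimers $\{i,i+1,i+2\}$ (horizontal dimers $\{i,i+2\}$ are not allowed); a tiling is a partition of the hexagons of $H_n$ into such tiles, and $H_0$ has one (empty) tiling. *)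

(* Defs.v *)
From mathcomp Require Import all_boot.
Set Implicit Arguments.
Unset Strict Implicit.
Unset Printing Implicit Defensive.

Fixpoint fib (n : nat) : nat :=
  match n with
  | 0 => 0
  | 1 => 1
  | (m.+1 as p).+1 => fib p + fib m
  end.

(* The hexagons of the strip H_n are the elements of 'I_n; i : 'I_n stands    *)
(* for the hexagon numbered i + 1.                                            *)
Section Tiles.
Variable n : nat.
Implicit Types (B : {set 'I_n}) (P : {set {set 'I_n}}).

Definition monomer B : bool := [exists i : 'I_n, B == [set i]].

Definition slanted_dimer B : bool :=
  [exists i : 'I_n, exists j : 'I_n, (j == i.+1 :> nat) && (B == [set i; j])].

Definition trimer B : bool :=
  [exists i : 'I_n, exists j : 'I_n, exists l : 'I_n,
    [&& j == i.+1 :> nat, l == i.+2 :> nat & B == [set i; j; l]]].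

Definition tile B : bool := [|| monomer B, slanted_dimer B | trimer B].

Definition tiling P : bool :=
  partition P [set: 'I_n] && [forall B in P, tile B].

Definition num_trimers P : nat := #|[set B in P | trimer B]|.

End Tiles.

Definition t (n k : nat) : nat :=
  #|[set P : {set {set 'I_n}} | tiling P && (num_trimers P == k)]|.

(* Main.v *)
Require Import Defs.
From mathcomp Require Import all_boot ssralg poly zify.

(** Both sides satisfy, for the initial segments of the strip, the recurrence
    [t (m + 3) (k + 1) = t (m + 2) (k + 1) + t (m + 1) (k + 1) + t m k].
    For tilings, delete the tile containing the last hexagon: it must end there,
    so it is the interval formed by the last one, two or three hexagons.
    Working with tilings of the segments of one fixed strip avoids transporting
    sets between different ordinal types.  For the Fibonacci sums, let [G] be the
    generating polynomial of the [fib j] truncated at degree [M]; the sum is the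
    coefficient of [X^(m+1)] in [X^(2k) G^(k+1)], and the recurrence comes from
    [G = X + X G + X^2 G] modulo [X^M]. *)

(** * Tilings of the initial segments of the strip *)

Section Tilings.

Variable n : nat.
Implicit Types (B : {set 'I_n}) (P Q : {set {set 'I_n}}) (a b m k : nat).

Definition interval a b : {set 'I_n} := [set i : 'I_n | a <= i < b].

Lemma interval_inj a b a' b' : a < b <= n -> a' < b' <= n ->
  interval a b = interval a' b' -> a = a' /\ b = b'.
Proof.
move=> ab ab' /setP E.
have F i : i < n -> (a <= i < b) = (a' <= i < b').
  by move=> lt_in; move: (E (Ordinal lt_in)); rewrite !inE.
(* Comparing membership of the first and last elements of both intervals suffices. *)
have := F a; have := F a'; have := F b.-1; have := F b'.-1; lia.
Qed.

Lemma trimerP B :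
  reflect (exists2 a, a.+2 < n & B = interval a a.+3) (trimer B).
Proof.
apply: (iffP existsP) => [[i /existsP[j /existsP[l /and3P[/eqP ji /eqP li /eqP->]]]]|].
  exists i; first by rewrite -li.
  by apply/setP=> x; rewrite !inE -!val_eqE /= ji li; lia.
case=> a lt_an ->.
have lt1 : a.+1 < n by lia.
have lt0 : a < n by lia.
exists (Ordinal lt0); apply/existsP; exists (Ordinal lt1); apply/existsP.
exists (Ordinal lt_an); rewrite /= !eqxx /=; apply/eqP/setP=> x.
by rewrite !inE -!val_eqE /=; lia.
Qed.

Lemma tileP B :
  reflect (exists a b, a < b <= a + 3 /\ b <= n /\ B = interval a b) (tile B).
Proof.
apply: (iffP or3P) => [|[a [b [ab [bn ->]]]]].
  case=> [/existsP[i /eqP->]|/existsP[i /existsP[j /andP[/eqP ji /eqP->]]]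
         |/trimerP[a lt_an ->]].
  - exists i, i.+1; do 2!(split; first by move: (ltn_ord i); lia).
    by apply/setP=> x; rewrite !inE -!val_eqE /=; lia.
  - exists i, i.+2; do 2!(split; first by have := ltn_ord j; lia).
    by apply/setP=> x; rewrite !inE -!val_eqE /= ji; lia.
  - by exists a, a.+3; split; [lia | split].
have lt0 : a < n by lia.
have [b1|[b2|b3]] : b = a.+1 \/ b = a.+2 \/ b = a.+3 by lia.
- apply: Or31; apply/existsP; exists (Ordinal lt0); apply/eqP/setP=> x.
  by rewrite !inE -!val_eqE /=; lia.
- have lt1 : a.+1 < n by lia.
  apply: Or32; apply/existsP; exists (Ordinal lt0); apply/existsP.
  exists (Ordinal lt1); rewrite /= eqxx; apply/eqP/setP=> x.
  by rewrite !inE -!val_eqE /=; lia.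
- by apply: Or33; apply/trimerP; exists a; [lia | rewrite b3].
Qed.

Lemma trimer_interval a b : a < b <= n -> trimer (interval a b) = (b == a + 3).
Proof.
move=> ab; apply/trimerP/eqP=> [[c cn E]|bE].
  by have := interval_inj _ _ _ _ ab _ E; lia.
by exists a; [lia | rewrite bE addn3].
Qed.

Definition segment_tilings m k : {set {set {set 'I_n}}} :=
  [set P | [&& partition P (interval 0 m), [forall B in P, tile B]
             & num_trimers P == k]].

Lemma t_segment_tilings k : t n k = #|segment_tilings n k|.
Proof.
apply: eq_card => P; rewrite !inE /tiling andbA.
suff -> : [set: 'I_n] = interval 0 n by [].
by apply/setP=> i; rewrite !inE ltn_ord.
Qed.

Lemma num_trimersU1 B Q : B \notin Q ->
  num_trimers (B |: Q) = trimer B + num_trimers Q.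
Proof.
move=> BQ; rewrite /num_trimers -!sum1dep_card !big_mkcondr /=.
by rewrite big_setU1 //=; case: (trimer B).
Qed.

Lemma interval_notin_segment_tiling a m P :
  a <= m -> m < n -> partition P (interval 0 a) -> interval a m.+1 \notin P.
Proof.
move=> am mn pP; apply/negP=> BP.
have /subsetP /(_ (Ordinal mn)) : interval a m.+1 \subset interval 0 a.
  by rewrite -(cover_partition pP); apply: bigcup_sup.
by rewrite !inE /=; lia.
Qed.

(** Deleting the last tile leaves a tiling of the first [a] hexagons, and adding it back is the
    inverse. The summand [m.+1 == a + 3] is 1 exactly when that tile is a trimer. *)
Lemma segment_tilings_last_tile a m k : a <= m -> m < n -> m < a + 3 ->
  [set P in segment_tilings m.+1 k | interval a m.+1 \in P] =
  [set interval a m.+1 |: Q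
    | Q in [set Q | [&& partition Q (interval 0 a), [forall B in Q, tile B]
                      & (m.+1 == a + 3) + num_trimers Q == k]]].
Proof.
move=> am mn ma; set B := interval a m.+1.
have tB : tile B by apply/tileP; exists a, m.+1; do !split; lia.
have triB : trimer B = (m.+1 == a + 3) by apply: trimer_interval; lia.
have mB : Ordinal mn \in B by rewrite inE /=; lia.
apply/setP=> P; rewrite !inE; apply/idP/imsetP=> [|[Q]].
  case/andP=> /and3P[pP /forall_inP tP /eqP nP] BP.
  exists (P :\ B); last by rewrite setD1K.
  have pQ : partition (P :\ B) (interval 0 a).
    have -> : interval 0 a = interval 0 m.+1 :\: B.
      by apply/setP=> i; rewrite !inE; lia.
    exact: partitionD1.
  rewrite inE pQ -nP -triB -num_trimersU1 ?setD11 // setD1K // eqxx andbT /=.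
  by apply/forall_inP=> C /setD1P[_ /tP].
rewrite inE => /and3P[pQ /forall_inP tQ /eqP nQ] ->.
have BQ := interval_notin_segment_tiling _ _ _ am mn pQ.
rewrite setU11 andbT num_trimersU1 // triB nQ eqxx andbT; apply/andP; split.
  have -> : interval 0 m.+1 = B :|: interval 0 a.
    by apply/setP=> i; rewrite !inE; lia.
  apply: partitionU1 pQ _ _; first by apply/set0Pn; exists (Ordinal mn).
  by rewrite -setI_eq0; apply/eqP/setP=> i; rewrite !inE; lia.
by apply/forall_inP=> C /setU1P[->|/tQ].
Qed.

Lemma card_segment_tilings_last_tile a m k : a <= m -> m < n -> m < a + 3 ->
  #|[set P in segment_tilings m.+1 ((m.+1 == a + 3) + k) | interval a m.+1 \in P]| =
  #|segment_tilings a k|.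
Proof.
move=> am mn ma; rewrite segment_tilings_last_tile // card_in_imset.
  by apply: eq_card => Q; rewrite !inE eqn_add2l.
move=> Q R; rewrite !inE => /and3P[pQ _ _] /and3P[pR _ _] E.
rewrite -(setU1K (interval_notin_segment_tiling _ _ _ am mn pQ)) E.
by rewrite setU1K // (interval_notin_segment_tiling _ _ _ am mn pR).
Qed.

(** The block of the last hexagon has one of three possible starting points. The guards stop [m.-1]
    and [m.-2], truncated at 0, from counting the same interval twice. *)
Lemma last_tile_unique m k P : m < n -> P \in segment_tilings m.+1 k ->
  1 = (interval m m.+1 \in P) + ((0 < m) && (interval m.-1 m.+1 \in P))
      + ((1 < m) && (interval m.-2 m.+1 \in P)).
Proof.
move=> mn; rewrite inE => /and3P[pP /forall_inP tP _].
have [/eqP cP trP _] := and3P pP.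
have mP : Ordinal mn \in cover P by rewrite cP inE /=.
have BP := pblock_mem mP; have /tileP[a [b [ab [bn defB]]]] := tP _ BP.
have mB : Ordinal mn \in interval a b by rewrite -defB mem_pblock.
rewrite inE /= in mB.
have {}bn : b = m.+1.
  have bn1 : b.-1 < n by lia.
  have /subsetP /(_ (Ordinal bn1)) : interval a b \subset interval 0 m.+1.
    by rewrite -defB -cP; apply: (bigcup_sup _ BP).
  by rewrite !inE /=; lia.
subst b.
have inP c : c <= m -> (interval c m.+1 \in P) = (c == a).
  move=> cm; apply/idP/eqP=> [cP'|->]; last by rewrite -defB.
  have mc : Ordinal mn \in interval c m.+1 by rewrite inE /=; lia.
  have E := def_pblock trP cP' mc; rewrite defB in E.
  by have := interval_inj _ _ _ _ _ _ E; lia.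
by rewrite !inP; lia.
Qed.

Lemma card_segment_tilings0 k : #|segment_tilings 0 k| = (k == 0).
Proof.
have -> : segment_tilings 0 k = if k == 0 then [set set0] else set0.
  apply/setP=> P; rewrite inE.
  have -> : interval 0 0 = set0 by apply/setP=> i; rewrite !inE ltn0 andbF.
  have n0 : num_trimers (set0 : {set {set 'I_n}}) = 0.
    by apply/eqP; rewrite cards_eq0; apply/eqP/setP=> B; rewrite !inE.
  rewrite partition_set0; have [->|nP] := eqVneq P set0.
    rewrite n0 eq_sym; case: eqP => _; rewrite !inE ?eqxx ?andbF ?andbT //=.
    by apply/forall_inP=> B; rewrite inE.
  by case: ifP; rewrite !inE //= (negbTE nP).
by case: eqP; rewrite ?cards1 ?cards0.
Qed.

Lemma card_segment_tilingsS m k : m < n ->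
  #|segment_tilings m.+1 k| =
    #|segment_tilings m k| + (0 < m) * #|segment_tilings m.-1 k|
    + (1 < m) * (0 < k) * #|segment_tilings m.-2 k.-1|.
Proof.
move=> mn; rewrite -[LHS]sum1_card.
have cnt a : \sum_(P in segment_tilings m.+1 k) (interval a m.+1 \in P : nat) =
    #|[set P in segment_tilings m.+1 k | interval a m.+1 \in P]|.
  by rewrite -sum1dep_card big_mkcondr /=; apply: eq_bigr => P _; case: (_ \in P).
rewrite (eq_bigr _ (fun P => last_tile_unique m k P mn)) !big_split /=.
congr (_ + _ + _).
- rewrite cnt -(card_segment_tilings_last_tile m m k) ?addn3 //; last lia.
  by rewrite (_ : m.+1 == m.+3 = false) //; lia.
- case: m mn cnt => [|m] mn cnt; first by rewrite mul0n big1.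
  rewrite mul1n /= cnt -(card_segment_tilings_last_tile m m.+1 k) //; try lia.
  by rewrite (_ : m.+2 == m + 3 = false) //; lia.
- case: m mn cnt => [|[|m]] mn cnt; try by rewrite mul0n big1.
  rewrite mul1n /= cnt.
  case: k cnt => [|k] _.
    (* For [k = 0] no tiling can end in a trimer, since that trimer alone makes the count
       positive. *)
    rewrite mul0n segment_tilings_last_tile; try lia.
    apply/eqP; rewrite cards_eq0; apply/eqP/setP=> P; rewrite [RHS]inE.
    apply/imsetP=> -[Q]; rewrite inE addn3 eqxx /= => /and3P[_ _].
    by rewrite addSn.
  rewrite mul1n -(card_segment_tilings_last_tile m m.+2 k) //; try lia.
  by rewrite addn3 eqxx.
Qed.

End Tilings.

(** * The generating polynomial of the Fibonacci sums *)

Section FibonacciConvolution.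

Import GRing.Theory.
Local Open Scope ring_scope.

Variable M : nat.

Definition fib_poly : {poly nat} := \poly_(j < M) fib j.

Definition fib_conv (k : nat) : {poly nat} := 'X^(2 * k) * fib_poly ^+ k.+1.

Lemma coef_fib_conv k N :
  (fib_conv k)`_N =
  (\sum_(i : {ffun 'I_k.+1 -> 'I_M} | \sum_(j < k.+1) i j + 2 * k == N)
      \prod_(j < k.+1) fib (i j))%N.
Proof.
have -> : fib_conv k = \sum_(i : {ffun 'I_k.+1 -> 'I_M})
    (\prod_(j < k.+1) fib (i j))%N *: 'X^(\sum_(j < k.+1) i j + 2 * k)%N.
  rewrite /fib_conv; have -> : fib_poly ^+ k.+1 = \prod_(j < k.+1) \sum_(i < M) fib i *: 'X^i.
    by rewrite prodr_const card_ord -poly_def.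
  rewrite bigA_distr_bigA mulr_sumr; apply: eq_bigr => i _ /=.
  by rewrite scaler_prod prodrXr -scalerAr -exprD addnC.
rewrite coef_sum [RHS]big_mkcond /=; apply: eq_bigr => i _.
by rewrite coefZ coefXn eq_sym; case: eqP => _; rewrite ?mulr1 ?mulr0.
Qed.

Hypothesis M_gt1 : (1 < M)%N.

(** Over [nat] there is no subtraction, so the truncation error is added on the left: the shifted
    copies of [fib_poly] reach the degrees [M] and [M + 1], with coefficients [fib M] and
    [fib M.-1]. *)
Lemma fib_poly_rec :
  fib_poly + 'X^M * ((fib M)%:P + fib M.-1 *: 'X) =
  'X + 'X * fib_poly + 'X^2 * fib_poly.
Proof.
rewrite /fib_poly; case: M M_gt1 => [|[|m]] // _; apply/polyP=> N.
rewrite !coefD !coefXnM !coefXM coefX !coef_poly coefD coefC coefZ coefX.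
case: N => [|[|N]] //; rewrite subn2 !subSS natn !natrDE !natrME !ltnS.
have fibSS j : fib j.+2 = (fib j.+1 + fib j)%N by [].
rewrite !fibSS; move: fib {fibSS} => F /=.
(* The degree is now [N + 2] and [M = m + 2]: it lies below [M], equals [M] or [M + 1], or exceeds
   both. *)
have [Nm|mN] := ltnP N m; first by rewrite (ltnW Nm) (leqW (ltnW Nm)) addn0.
have [->|] := eqVneq N m; first by rewrite subnn leqnn leqnSn muln0 addn0.
have [-> _|Nm1 Nm] := eqVneq N m.+1; first by rewrite subSnn ltnn leqnn muln1.
have -> : (N - m == 0 = false)%N by lia.
have -> : (N - m == 1 = false)%N by lia.
have -> : (N <= m = false)%N by lia.
have -> : (N <= m.+1 = false)%N by lia.
by rewrite muln0.
Qed.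

Lemma coef_fib_poly_mul (Z : {poly nat}) N : (N < M)%N ->
  (fib_poly * Z)`_N =
  ('X * Z)`_N + ('X * (fib_poly * Z))`_N + ('X^2 * (fib_poly * Z))`_N.
Proof.
move=> NM; have := congr1 (fun p => (p * Z)`_N) fib_poly_rec.
by rewrite !mulrDl -!mulrA !coefD [('X^M * _)`_N]coefXnM NM addr0.
Qed.

Lemma coef0_fib_conv k : (fib_conv k)`_0 = 0.
Proof.
rewrite /fib_conv exprS mulrCA coef0M coef_poly; case: ifP => _ /=; exact: mul0r.
Qed.

Lemma coef1_fib_conv k : (fib_conv k)`_1 = (k == 0)%N.
Proof.
rewrite /fib_conv; case: k => [|k]; first by rewrite mul1r expr1 coef_poly M_gt1.
by rewrite coefXnM mulnS.
Qed.

(** Expand one of the factors [fib_poly]. For [0 < k] its term ['X] leaves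
    ['X^(2 * k + 1) * fib_poly ^+ k], which is ['X^3 * fib_conv k.-1]. *)
Lemma fib_conv_rec k m : (m.+2 < M)%N ->
  (fib_conv k)`_m.+2 =
  (fib_conv k)`_m.+1 + (fib_conv k)`_m + ((0 < k) * ((fib_conv k.-1)`_m.-1)%R)%N.
Proof.
move=> mM; have E : fib_conv k = fib_poly * ('X^(2 * k) * fib_poly ^+ k).
  by rewrite /fib_conv exprS mulrCA.
rewrite {1}E coef_fib_poly_mul // -E !coefXM [('X^2 * _)`__]coefXnM /= subSS subSS subn0.
rewrite -addrA addrC; congr (_ + _).
case: k E => [|k] _ /=; first by rewrite mul1r expr0 coef1 mul0n.
rewrite mul1n mulnS exprD -mulrA -/(fib_conv k) coefXnM.
(* At [m = 0] the truncated index [m.-1] reads the constant coefficient, which is zero. *)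
case: m mM => [|m] _ /=; last by rewrite subn2.
by rewrite coef0_fib_conv.
Qed.

End FibonacciConvolution.

(** The truncation at [n.+2] leaves every degree up to [n + 1] exact. Where a guard of the tiling
    recurrence on [m] fails, the matching coefficient is the constant one, hence zero. *)
Lemma card_segment_tilings_fib_conv n m k : m <= n ->
  #|segment_tilings n m k| = ((fib_conv n.+2 k)`_m.+1)%R.
Proof.
elim/ltn_ind: m k => -[|m] IH k mn.
  by rewrite card_segment_tilings0 coef1_fib_conv.
rewrite card_segment_tilingsS // fib_conv_rec //; congr (_ + _ + _).
- by rewrite IH //; lia.
- case: m IH mn => [|m] IH mn; first by rewrite mul0n coef0_fib_conv.
  by rewrite mul1n IH //=; lia.
- case: m IH mn => [|[|m]] IH mn /=; rewrite ?coef0_fib_conv ?muln0 //.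
  by rewrite mul1n IH //; lia.
Qed.

(* The index set is {(i_0, ..., i_k) | i_0 + ... + i_k = n - 2k + 1}. Its     *)
(* constraint is written additively, so that the sum is empty when            *)
(* n - 2k + 1 < 0; it forces each i_j <= n + 1, so letting i_j range over     *)
(* 'I_n.+2 loses nothing.                                                     *)
Theorem theorem9 (n k : nat) :
  t n k =
    \sum_(i : {ffun 'I_k.+1 -> 'I_n.+2} | \sum_(j < k.+1) i j + 2 * k == n + 1)
      \prod_(j < k.+1) fib (i j).
Proof.
by rewrite t_segment_tilings card_segment_tilings_fib_conv // coef_fib_conv addn1.
Qed.
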